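(* Let $(\mathbf e^{(p)})_{p\ge0}$ be a sequence produced by the continuous (infinite-sample) version of the NSMM algorithm, i.e. $\mathbf e^{(0)}$ satisfies assumptions (ii) and (vi) of the context and $\mathbf e^{(p+1)}=G(\mathbf e^{(p)})$ for all $p\ge0$, with associated weights $w_j^{(p)}$. Then at any step $p$, $$l(\mathbf e^{(p)})-l(\mathbf e^{(p+1)})=\sum_{j=1}^mKL\bigl(e_j^{(p+1)},e_j^{(p)}\bigr)+\sum_{j=1}^mKL\bigl(g\cdot w_j^{(p)},\,g\cdot w_j^{(p+1)}\bigr).$$
   Context: Setting. $\Omega=[a,b]^r\subset\mathbb R^r$ with $a<b$; $g$ is a probability density on $\mathbb R^r$ (the target) with support in the interior of $\Omega$; $h\in\mathbb R$ is a given bandwidth; $s_h\in L^1(\mathbb R\times\mathbb R)$ is nonnegative with support in $[a,b]\times[a,b]$. Assumptions. (i) The number $m$ of mixing components in $g$ is fixed, and there exist nonnegative functions $e_1,\dots,e_m$ with $g(\mathbf x)=\sum_{j=1}^m e_j(\mathbf x)$. (ii) For each $1\le j\le m$, $e_j(\mathbf x)=\theta_j\prod_{k=1}^r e_{j,k}(x_k)$, where $\theta_j>0$ and each $e_{j,k}\in L^1(\mathbb R)$ is positive with support in $[a,b]$. (iii) $\int s_h(v,u)\,du=\int s_h(u,z)\,du=1$ for $v,z\in[a,b]$. (iv) There are positive numbers $M_1(h)$ and $M_2$ with $M_1(h)\le s_h(v,z)\le M_2$ for all $v,z\in[a,b]$. (v) $s_h$ has continuous first-order partial derivatives on $(a,b)\times(a,b)$,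 both bounded there in absolute value by a constant $B$. (vi) With $f_j(\mathbf x)=e_j(\mathbf x)/\int e_j(\mathbf z)\,d\mathbf z$, one has $f_j(\mathbf x)\ge(M_1(h))^r$ for all $\mathbf x\in\Omega$ and each $j$. Candidates. The $m$-tuple $\mathbf e=(e_1,\dots,e_m)$ is the unknown to be estimated. The only assumptions that impose constraints on a candidate $\mathbf e$ are (ii) and (vi); in particular it is not required that $\sum_je_j$ be a density. Smoothing. $\tilde s_h(\mathbf x,\mathbf u)=\prod_{k=1}^r s_h(x_k,u_k)$; $(S_h^*f)(\mathbf x)=\int\tilde s_h(\mathbf u,\mathbf x)f(\mathbf u)\,d\mathbf u$; $(\mathcal N_hf)(\mathbf x)=\exp[(S_h^*\log f)(\mathbf x)]$ for $\mathbf x\in\Omega$ and $0$ elsewhere (integrals against $\tilde s_h$ are effectively over $\Omega$). Objective. $l(\mathbf e)=\int g(\mathbf x)\log\dfrac{g(\mathbf x)}{\sum_{j=1}^m(\mathcal N_he_j)(\mathbf x)}\,d\mathbf x+\int\sum_{j=1}^m e_j(\mathbf x)\,d\mathbf x$. Kullback-Leibler divergence of nonnegative functions: $KL(g_1,g_2)=\int\left[g_1\log\frac{g_1}{g_2}+g_2-g_1\right]$. NSMM (nonlinearly smoothed majorization-minimization) step. For $\mathbf e^{(p)}$ put $w_j^{(p)}(\mathbf x)=(\mathcal N_he_j^{(p)})(\mathbf x)\big/\sum_{j'=1}^m(\mathcal N_he_{j'}^{(p)})(\mathbf x)$, and $$(G(\mathbf e^{(p)}))_j(\mathbf u)=\frac{\prod_{k=1}^r\int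 g(\mathbf x)w_j^{(p)}(\mathbf x)s_h(u_k,x_k)\,d\mathbf x}{\left[\int g(\mathbf x)w_j^{(p)}(\mathbf x)\,d\mathbf x\right]^{r-1}},\qquad 1\le j\le m.$$ *)

(* Defs.v *)
From HB Require Import structures.
From mathcomp Require Import all_boot all_order all_algebra.
From mathcomp Require Import all_classical all_reals all_analysis.

Set Implicit Arguments.
Unset Strict Implicit.
Unset Printing Implicit Defensive.

Import Order.TTheory GRing.Theory Num.Theory.
Import numFieldNormedType.Exports.

Local Open Scope classical_set_scope.
Local Open Scope ring_scope.

(* The library has the product sigma-algebra on n.-tuple R but no Lebesgue
   measure there: lebesgue_tuple n is the n-fold product of lebesgue_measure,
   as lebesgue_tuple_box checks. *)
Section lebesgue_tuple.
Context (R : realType).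
Local Notation leb := (@lebesgue_measure R).

Definition tcons n (p : R * n.-tuple R) : n.+1.-tuple R :=
  [tuple of p.1 :: p.2].

Lemma measurable_tcons n : measurable_fun setT (@tcons n).
Proof. exact: (measurable_cons measurable_fst measurable_snd). Qed.

Section step.
Context n (mu : {sigma_finite_measure set (n.-tuple R) -> \bar R}).
Local Open Scope ereal_scope.

Definition lebesgue_cons : set (n.+1.-tuple R) -> \bar R :=
  pushforward (leb \x mu) (@tcons n).

Let measurable_preimage_tcons A :
  measurable A -> measurable (@tcons n @^-1` A).
Proof. by move=> mA; rewrite -[X in measurable X]setTI; exact: measurable_tcons. Qed.

Let lebesgue_cons0 : lebesgue_cons set0 = 0.
Proof. by rewrite /lebesgue_cons /pushforward preimage_set0 measure0. Qed.

Let lebesgue_cons_ge0 A : 0 <= lebesgue_cons A.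
Proof. exact: (measure_ge0 (leb \x mu)). Qed.

Let lebesgue_cons_sigma_additive : semi_sigma_additive lebesgue_cons.
Proof.
move=> F mF tF mUF; rewrite /lebesgue_cons /pushforward preimage_bigcup.
apply: measure_semi_sigma_additive.
- by move=> i; exact: measurable_preimage_tcons.
- apply/trivIsetP => /= i j _ _ ij; rewrite -preimage_setI.
  by move/trivIsetP : tF => /(_ _ _ _ _ ij) ->//; rewrite preimage_set0.
- by rewrite -preimage_bigcup; exact: measurable_preimage_tcons.
Qed.

HB.instance Definition _ := isMeasure.Build _ _ _ lebesgue_cons
  lebesgue_cons0 lebesgue_cons_ge0 lebesgue_cons_sigma_additive.

Let uncons (x : n.+1.-tuple R) : R * n.-tuple R :=
  (thead x, [tuple of behead x]).

Let tconsK : cancel (@tcons n) uncons.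
Proof.
by move=> [x t]; rewrite /uncons /tcons/= theadE; congr (_, _); exact: val_inj.
Qed.

Let measurable_uncons : measurable_fun setT uncons.
Proof.
apply: measurable_fun_pair; last exact: measurable_behead.
exact: (@measurable_tnth _ (measurableTypeR R) n.+1 ord0).
Qed.

Let lebesgue_cons_sigma_finite : sigma_finite setT lebesgue_cons.
Proof.
have /sigma_finiteP[F [TF ndF Foo]] := sigma_finiteT leb.
have /sigma_finiteP[G [TG ndG Goo]] := sigma_finiteT mu.
exists (fun i => uncons @^-1` (F i `*` G i)).
  rewrite -preimage_bigcup (_ : \bigcup_i _ = setT) ?preimage_setT//.
  rewrite -subTset => -[x y] _.
  have [i _ Fix] : (\bigcup_i F i) x by rewrite -TF.
  have [k _ Gky] : (\bigcup_i G i) y by rewrite -TG.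
  exists (maxn i k) => //; split.
  - by move: x Fix; exact/subsetPset/ndF/leq_maxl.
  - by move: y Gky; exact/subsetPset/ndG/leq_maxr.
move=> i; have [mF Fi] := Foo i; have [mG Gi] := Goo i; split.
  rewrite -[X in measurable X]setTI; apply: measurable_uncons => //.
  exact: measurableX.
rewrite /lebesgue_cons /pushforward -comp_preimage.
rewrite (_ : uncons \o _ = id); last by apply/funext => x /=; rewrite tconsK.
by rewrite preimage_id product_measure1E// lte_mul_pinfty// ge0_fin_numE.
Qed.

HB.instance Definition _ := Measure_isSigmaFinite.Build _ _ _ lebesgue_cons
  lebesgue_cons_sigma_finite.

End step.

Fixpoint lebesgue_tuple n : {sigma_finite_measure set (n.-tuple R) -> \bar R} :=
  match n with
  | 0 => \d_[tuple]
  | n'.+1 => lebesgue_cons (lebesgue_tuple n')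
  end.

Lemma lebesgue_tuple_box n (A : 'I_n -> set R) :
  (forall i, measurable (A i)) ->
  lebesgue_tuple n [set x | forall i, A i (tnth x i)] =
  (\prod_(i < n) leb (A i))%E.
Proof.
elim: n A => [|n IH] A mA /=.
  by rewrite big_ord0 diracE mem_set//= => -[].
rewrite big_ord_recl -IH // -product_measure1E //.
- rewrite /lebesgue_cons /pushforward; congr product_measure1.
  apply/seteqP; split => [[x t]/= xt|[x t]/= [Ax At] i].
    split; first by have := xt ord0; rewrite tnth0.
    by move=> i; have := xt (lift ord0 i); rewrite tnthS.
  case: (unliftP ord0 i) => [j ->|->]; first by rewrite tnthS.
  by rewrite tnth0.
- exact: mA.
- rewrite (_ : [set x | _] = \bigcap_(i in [set: 'I_n])
    (fun x : n.-tuple R => tnth x i) @^-1` A (lift ord0 i)).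
    apply: fin_bigcap_measurable => // i _; rewrite -[X in measurable X]setTI.
    exact: measurable_tnth.
  by apply/seteqP; split => x /= xA i => [_|]; exact: xA.
Qed.

End lebesgue_tuple.

Section smoothing.
Context (R : realType) (r : nat) (a b : R).
Local Notation leb := (@lebesgue_measure R).
Local Notation lebr := (@lebesgue_tuple R r).
Local Notation point := (r.-tuple R).

Definition Omega : set point := [set x | forall k, tnth x k \in `[a, b]].

Definition fsupport (T : topologicalType) (f : T -> R) : set T :=
  closure [set x | f x != 0].

(* The library puts the product topology on row vectors, not on tuples. *)
Definition row_point (y : 'rV[R]_r) : point := [tuple y ord0 k | k < r].

Definition density (g : point -> R) :=
  [/\ measurable_fun setT g, forall x, 0 <= g x
    & (\int[lebr]_x (g x)%:E = 1)%E].

Definition support_in_interior_Omega (g : point -> R) :=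
  fsupport (g \o row_point) `<=` (row_point @^-1` Omega)°.

Definition bounded_C1_partials (s : R -> R -> R) (B : R) :=
  forall v z, v \in `]a, b[ -> z \in `]a, b[ ->
  [/\ derivable (s ^~ z) v 1 /\ derivable (s v) z 1,
      {for (v, z), continuous (fun p : R * R => 'D_1 (s ^~ p.2) p.1)} /\
      {for (v, z), continuous (fun p : R * R => 'D_1 (s p.1) p.2)}
    & `|'D_1 (s ^~ z) v| <= B /\ `|'D_1 (s v) z| <= B].

Record smoothing_kernel (s : R -> R -> R) (M1 M2 B : R) : Prop := {
  kernel_integrable :
    (leb \x leb)%E.-integrable setT (fun p => (s p.1 p.2)%:E);
  kernel_ge0 : forall v z, 0 <= s v z;
  kernel_support :
    fsupport (fun p : R * R => s p.1 p.2) `<=` `[a, b] `*` `[a, b];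
  kernel_integral1 : forall v z, v \in `[a, b] -> z \in `[a, b] ->
    (\int[leb]_u (s v u)%:E = 1)%E /\ (\int[leb]_u (s u z)%:E = 1)%E;
  kernel_bounds_gt0 : 0 < M1 /\ 0 < M2;
  kernel_bounds : forall v z, v \in `[a, b] -> z \in `[a, b] ->
    M1 <= s v z <= M2;
  kernel_partials : bounded_C1_partials s B }.

Definition product_component (f : point -> R) :=
  exists (theta : R) (fk : 'I_r -> R -> R),
  [/\ 0 < theta,
      forall k, [/\ leb.-integrable setT (EFin \o fk k),
                    forall t, t \in `[a, b] -> 0 < fk k t
                  & fsupport (fk k) `<=` `[a, b]]
    & forall x, f x = theta * \prod_(k < r) fk k (tnth x k)].

Definition component_lower_bound (M1 : R) (f : point -> R) :=
  forall x, x \in Omega -> M1 ^+ r <= f x / \int[lebr]_z f z.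

Section operators.
Variable s : R -> R -> R.

Definition prod_kernel (x u : point) : R :=
  \prod_(k < r) s (tnth x k) (tnth u k).

Definition smooth (f : point -> R) (x : point) : R :=
  \int[lebr]_u (prod_kernel u x * f u).

(* ln is 0 at 0, but prod_kernel u x vanishes for u outside Omega. *)
Definition nsmooth (f : point -> R) (x : point) : R :=
  if x \in Omega then expR (smooth (fun u => ln (f u)) x) else 0.

Context (m : nat).
Implicit Types e : 'I_m -> point -> R.

Definition weight e (j : 'I_m) (x : point) : R :=
  nsmooth (e j) x / \sum_(j' < m) nsmooth (e j') x.

Definition nsmm_step (g : point -> R) e (j : 'I_m) (u : point) : R :=
  (\prod_(k < r) \int[lebr]_x (g x * weight e j x * s (tnth u k) (tnth x k)))
  / (\int[lebr]_x (g x * weight e j x)) ^+ r.-1.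

End operators.

(* u log (u / v) for u, v >= 0, with 0 log (0 / v) = 0 and
   u log (u / 0) = +oo if u > 0. *)
Definition xlnx_ratio (u v : R) : \bar R :=
  if u == 0 then 0%E else if v == 0 then +oo%E else (u * ln (u / v))%:E.

Definition KL (g1 g2 : point -> R) : \bar R :=
  (\int[lebr]_x (xlnx_ratio (g1 x) (g2 x) + (g2 x)%:E - (g1 x)%:E))%E.

Definition objective (s : R -> R -> R) (g : point -> R) m
    (e : 'I_m -> point -> R) : \bar R :=
  (\int[lebr]_x xlnx_ratio (g x) (\sum_(j < m) nsmooth s (e j) x)%R
   + \int[lebr]_x (\sum_(j < m) e j x)%:E)%E.

End smoothing.

(* Main.v *)
(* Each w_j factors the mixture: with N e = sum_j N_h e_j, on Omega
   log (N e' / N e) = log (N_h e'_j / N_h e_j) + log (w_j / w'_j) for every j;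
   averaging this over j with the weights g w_j yields the second family of
   divergences plus the average of log (N_h e'_j / N_h e_j).  The latter is the
   first family, by the duality int e'_j log f = int g w_j S_h^* log f for
   product functions f: as log f is a sum of functions of one variable, only
   the one-dimensional marginals of e'_j matter, and those of the NSMM step are
   int g w_j s_h(u_k, x_k) dx.
   All logarithms of components are integrable because every iterate is a
   product whose factors are bounded away from 0 on [a,b].  The sole possibly
   infinite quantity is int g log g, which occurs in both objectives. *)

Require Import Defs.
From mathcomp Require Import all_boot all_order all_algebra.
From mathcomp Require Import all_classical all_reals all_analysis.
From mathcomp Require Import measurable_realfun measurable_fun_approximation.
From mathcomp Require Import ring.

Set Implicit Arguments.
Unset Strict Implicit.
Unset Printing Implicit Defensive.

Import Order.TTheory GRing.Theory Num.Theory.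
Import numFieldNormedType.Exports.

Local Open Scope classical_set_scope.
Local Open Scope ring_scope.

(** * Integrability and integrals of real-valued functions *)

Section real_integrable.
Context d (T : measurableType d) (R : realType).
Context (mu : {measure set T -> \bar R}).
Local Notation intble f := (mu.-integrable setT (fun x => (f x)%:E)).

Lemma integrableRD (f1 f2 : T -> R) :
  intble f1 -> intble f2 -> intble (fun x => f1 x + f2 x).
Proof.
move=> i1 i2; apply: eq_integrable (integrableD measurableT i1 i2) => //.
Qed.

Lemma integrableRB (f1 f2 : T -> R) :
  intble f1 -> intble f2 -> intble (fun x => f1 x - f2 x).
Proof.
move=> i1 i2; apply: eq_integrable (integrableB measurableT i1 i2) => //.
Qed.

Lemma integrableRZl (k : R) (f : T -> R) : intble f -> intble (fun x => k * f x).
Proof.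
move=> fi; apply: eq_integrable (integrableZl measurableT k fi) => //.
Qed.

Lemma integrableRZr (k : R) (f : T -> R) : intble f -> intble (fun x => f x * k).
Proof. by move=> /(integrableRZl k); under eq_fun do rewrite mulrC. Qed.

Lemma integrableR_sum I (s : seq I) (P : pred I) (f : I -> T -> R) :
  (forall i, P i -> intble (f i)) -> intble (fun x => \sum_(i <- s | P i) f i x).
Proof.
move=> fi; apply: eq_integrable (integrable_sum measurableT s fi) => //.
by move=> x _; rewrite sumEFin.
Qed.

Lemma measurable_intble (f : T -> R) : intble f -> measurable_fun setT f.
Proof. by move/measurable_int/measurable_EFinP. Qed.

Lemma le_integrableR (f1 f2 : T -> R) : measurable_fun setT f1 ->
  (forall x, `|f1 x| <= `|f2 x|) -> intble f2 -> intble f1.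
Proof.
move=> mf1 le12; apply: le_integrable => //; first exact/measurable_EFinP.
by move=> x _; rewrite /= lee_fin.
Qed.

(** The bound on [f2] is asked only where [f1] is nonzero: later [f1] is the density, which lives on
    [Omega], and [f2] is controlled there alone. *)
Lemma integrableR_bounded (f1 f2 : T -> R) (C : R) : intble f1 ->
  measurable_fun setT (fun x => f1 x * f2 x) ->
  (forall x, f1 x != 0 -> `|f2 x| <= C) -> intble (fun x => f1 x * f2 x).
Proof.
move=> fi m12 bd; apply: (le_integrableR m12 _ (integrableRZl C fi)) => x /=.
rewrite !normrM mulrC; have [->|/bd le2] := eqVneq (f1 x) 0.
  by rewrite normr0 !mulr0.
by rewrite ler_wpM2r// (le_trans le2)// ler_norm.
Qed.

Lemma EFin_Rintegral (f : T -> R) :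
  intble f -> (\int[mu]_x f x)%:E = (\int[mu]_x (f x)%:E)%E.
Proof. by move=> fi; rewrite fineK//; exact: integrable_fin_num fi. Qed.

Lemma Rintegral_sum I (s : seq I) (P : pred I) (f : I -> T -> R) :
  (forall i, intble (f i)) ->
  \int[mu]_x (\sum_(i <- s | P i) f i x) = \sum_(i <- s | P i) \int[mu]_x f i x.
Proof.
move=> fi; rewrite /Rintegral.
under eq_integral do rewrite -sumEFin.
rewrite (integral_sum measurableT fi).
rewrite (eq_bigr (fun i => (\int[mu]_x f i x)%:E)) ?sumEFin// => i _.
by rewrite -EFin_Rintegral.
Qed.

End real_integrable.

(** * Fubini for real-valued integrals *)

Section Fubini_real.
Context d1 d2 (T1 : measurableType d1) (T2 : measurableType d2) (R : realType).
Context (m1 : {sigma_finite_measure set T1 -> \bar R}).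
Context (m2 : {sigma_finite_measure set T2 -> \bar R}).

(** By Tonelli, the iterated integral of the absolute value factors into two finite integrals. *)
Lemma integrable_prodM (f1 : T1 -> R) (f2 : T2 -> R) :
  m1.-integrable setT (fun x => (f1 x)%:E) ->
  m2.-integrable setT (fun x => (f2 x)%:E) ->
  (m1 \x m2)%E.-integrable setT (fun p => (f1 p.1 * f2 p.2)%:E).
Proof.
move=> i1 i2.
have mf : measurable_fun setT (fun p : T1 * T2 => (f1 p.1 * f2 p.2)%:E).
  apply/measurable_EFinP/measurable_funM; apply: measurableT_comp => //.
    exact: measurable_intble i1.
  exact: measurable_intble i2.
apply/(integrable12ltyP _ _ mf) => /=.
under eq_integral => x _.
  under eq_integral do rewrite normrM EFinM.
  rewrite ge0_integralZl_EFin//; last first.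
    apply/measurable_EFinP; apply: measurableT_comp => //.
    exact: measurable_intble i2.
  over.
have /integrableP[_ oo1] := i1; have /integrableP[_ oo2] := i2.
rewrite ge0_integralZr//; last 2 first.
- apply/measurable_EFinP; apply: measurableT_comp => //.
  exact: measurable_intble i1.
- exact: integral_ge0.
by apply: lte_mul_pinfty => //; [exact: integral_ge0|rewrite ge0_fin_numE// integral_ge0].
Qed.

(** Sections are assumed integrable everywhere, not almost everywhere, so that the real inner
    integrals agree at every point with the extended ones and Fubini transfers without exceptional
    sets. *)
Lemma Fubini_fin (f : T1 -> T2 -> R) :
  (m1 \x m2)%E.-integrable setT (fun p => (f p.1 p.2)%:E) ->
  (forall x, m2.-integrable setT (fun y => (f x y)%:E)) ->
  (forall y, m1.-integrable setT (fun x => (f x y)%:E)) ->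
  [/\ m1.-integrable setT (fun x => (\int[m2]_y f x y)%:E),
      m2.-integrable setT (fun y => (\int[m1]_x f x y)%:E) &
      \int[m1]_x \int[m2]_y f x y = \int[m2]_y \int[m1]_x f x y].
Proof.
move=> fi f2i f1i.
have E1 : (fun x => (\int[m2]_y f x y)%:E) = (fun x => (\int[m2]_y (f x y)%:E)%E).
  by apply/funext => x; rewrite EFin_Rintegral.
have E2 : (fun y => (\int[m1]_x f x y)%:E) = (fun y => (\int[m1]_x (f x y)%:E)%E).
  by apply/funext => y; rewrite EFin_Rintegral.
split.
- by rewrite E1; exact: integrable_fubini_F fi.
(* The integral of the absolute value of the partial integral is at most the iterated integral of
   [|f|], which is finite by Tonelli. *)
- rewrite E2; apply/integrableP; split; first exact: measurable_fubini_G fi.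
  have mf := measurable_int _ fi.
  apply: le_lt_trans ((integrable21ltyP m1 m2 mf).1 fi).
  have mfa : measurable_fun setT (abse \o (fun p : T1 * T2 => (f p.1 p.2)%:E)).
    exact: measurableT_comp.
  apply: ge0_le_integral => //.
  + by apply: measurableT_comp => //; exact: measurable_fubini_G fi.
  + exact: (measurable_fun_fubini_tonelli_G _ mfa (fun=> abse_ge0 _)).
  + move=> y _; apply: le_abse_integral => //.
    exact: measurable_int (f1i y).
- by rewrite {1}/Rintegral E1 [in RHS]/Rintegral E2 (Fubini fi).
Qed.

End Fubini_real.

(** * Product functions under the Lebesgue measure on tuples *)

Section tuple_product.
Context (R : realType).
Local Notation leb := (@lebesgue_measure R).

Lemma integrable_lebesgue_cons n
    (mu : {sigma_finite_measure set (n.-tuple R) -> \bar R})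
    (F : n.+1.-tuple R -> \bar R) : measurable_fun setT F ->
  (leb \x mu)%E.-integrable setT (F \o @tcons R n) ->
  (lebesgue_cons mu).-integrable setT F /\
  (\int[lebesgue_cons mu]_x F x = \int[(leb \x mu)%E]_p F (tcons p))%E.
Proof.
move=> mF iF.
have mt : @measurable_fun _ _ (measurableTypeR R * n.-tuple R)%type _ setT
  (@tcons R n) by exact: measurable_tcons.
have iF' : (leb \x mu)%E.-integrable (@tcons R n @^-1` setT) (F \o @tcons R n).
  by rewrite preimage_setT.
split; first exact: (integrable_pushforward mt mF iF' measurableT).
exact: (integral_pushforward mt mF iF' measurableT).
Qed.

Lemma measurable_prod_tnth n (f : 'I_n -> R -> R) :
  (forall k, measurable_fun setT (f k)) ->
  measurable_fun setT (fun x : n.-tuple R => \prod_(k < n) f k (tnth x k)).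
Proof.
move=> mf; apply: measurable_prod => k _.
by apply: measurableT_comp => //; exact: measurable_tnth.
Qed.

(** Induction on [n]: [tcons] splits off the first coordinate, and Fubini factors the integral. In
    dimension 0 the empty product is 1 and the Dirac measure has mass 1. *)
Lemma lebesgue_tuple_prod n (f : 'I_n -> R -> R) :
  (forall k, leb.-integrable setT (fun t => (f k t)%:E)) ->
  (@lebesgue_tuple R n).-integrable setT
    (fun x => (\prod_(k < n) f k (tnth x k))%:E) /\
  \int[@lebesgue_tuple R n]_x (\prod_(k < n) f k (tnth x k)) =
  \prod_(k < n) \int[leb]_t f k t.
Proof.
elim: n f => [|n IH] f fi.
  have E : (fun x : 0.-tuple R => (\prod_(k < 0) f k (tnth x k))%:E) = cst 1%E.
    by apply/funext => x; rewrite big_ord0.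
  have mu1 : @lebesgue_tuple R 0 setT = 1%E by rewrite /= diracT.
  split.
    rewrite E; apply/integrableP; split => //.
    rewrite (eq_integral (cst 1%E)) => [|x _]; last by rewrite /= normr1.
    by rewrite integral_cst// mul1e; rewrite -[ltLHS]/(@lebesgue_tuple R 0 setT) mu1 ltry.
  rewrite /Rintegral E integral_cst// mul1e big_ord0; exact: (congr1 fine mu1).
have [ti tE] := IH (fun k => f (lift ord0 k)) (fun k => fi _).
have mf : measurable_fun setT
    (fun x : n.+1.-tuple R => (\prod_(k < n.+1) f k (tnth x k))%:E).
  apply/measurable_EFinP; apply: (measurable_prod_tnth (f := f)) => k.
  exact: measurable_intble (fi k).
have fE p : (\prod_(k < n.+1) f k (tnth (tcons p) k)) =
    f ord0 p.1 * \prod_(k < n) f (lift ord0 k) (tnth p.2 k) :> R.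
  rewrite big_ord_recl tnth0; congr (_ * _).
  by apply: eq_bigr => k _; rewrite tnthS.
have pi : (leb \x @lebesgue_tuple R n)%E.-integrable setT
    ((fun x => (\prod_(k < n.+1) f k (tnth x k))%:E) \o @tcons R n).
  apply: eq_integrable (integrable_prodM (fi ord0) ti) => //.
  by move=> p _ /=; rewrite fE.
have [i1 i2] := integrable_lebesgue_cons mf pi.
split=> //.
rewrite {1}/Rintegral i2 -(integral12_prod_meas1 pi) big_ord_recl -tE.
rewrite /fubini_F /=.
under eq_integral => x _.
  under eq_integral do rewrite fE/= EFinM.
  rewrite integralZl// -EFin_Rintegral//.
  over.
rewrite integralZr// fineM//; exact: integrable_fin_num (fi ord0).
Qed.

End tuple_product.

(** * The one-dimensional smoothing kernel *)

Section kernel.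
Context (R : realType) (a b : R) (s : R -> R -> R) (M1 M2 B : R).
Context (sk : smoothing_kernel a b s M1 M2 B).
Local Notation leb := (@lebesgue_measure R).
Local Notation T1 := (measurableTypeR R).

Lemma fsupportP (T : topologicalType) (f : T -> R) (A : set T) x :
  fsupport f `<=` A -> ~ A x -> f x = 0.
Proof.
move=> fA nAx; apply/eqP; apply: contrapT => /negP fx0; apply: nAx.
by apply: fA; exact: subset_closure.
Qed.

Lemma kernel_off v z : ~~ ((v \in `[a, b]) && (z \in `[a, b])) -> s v z = 0.
Proof.
move=> vz; apply: (fsupportP (x := (v, z)) (kernel_support sk)) => -[/= v1 z1].
by move: vz; rewrite v1 z1.
Qed.

Lemma kernel_le v z : s v z <= M2.
Proof.
have [/andP[v1 z1]|/kernel_off->] := boolP ((v \in `[a, b]) && (z \in `[a, b])).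
  by have /andP[] := kernel_bounds sk v1 z1.
by have [_ /ltW] := kernel_bounds_gt0 sk.
Qed.

Lemma kernel_norm v z : `|s v z| <= M2.
Proof. by rewrite ger0_norm ?kernel_le ?(kernel_ge0 sk). Qed.

Lemma measurable_kernel :
  measurable_fun setT (fun p : T1 * T1 => s p.1 p.2).
Proof. exact: measurable_intble (kernel_integrable sk). Qed.

Lemma measurable_kernel_comp d (T : measurableType d) (f1 f2 : T -> T1) :
  measurable_fun setT f1 -> measurable_fun setT f2 ->
  measurable_fun setT (fun x => s (f1 x) (f2 x)).
Proof.
move=> m1 m2.
by have := measurableT_comp measurable_kernel (measurable_fun_pair m1 m2).
Qed.

(** Valid for every [z]: the nonnegative section has mass 1 if [z] is in the interval and vanishes
    identically otherwise. *)
Lemma integrable_kernel z : leb.-integrable setT (fun t => (s t z)%:E).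
Proof.
have ms : measurable_fun setT (fun t : T1 => s t z).
  exact: measurable_kernel_comp.
apply/integrableP; split; first exact/measurable_EFinP.
under eq_integral do rewrite gee0_abs ?lee_fin ?(kernel_ge0 sk)//.
have [zab|zab] := boolP (z \in `[a, b]).
  by have [_ ->] := kernel_integral1 sk zab zab; rewrite ltry.
rewrite integral0_eq// => t _.
by rewrite kernel_off// (negbTE zab) andbF.
Qed.

Lemma Rintegral_kernel z : z \in `[a, b] -> \int[leb]_t s t z = 1.
Proof.
by move=> zab; have [_ E] := kernel_integral1 sk zab zab; rewrite /Rintegral E.
Qed.

(** The kernel is bounded by [M2]. Its arguments are arbitrary measurable maps, so that the lemma
    also serves on product spaces before Fubini. *)
Lemma integrable_kernelM d (T : measurableType d) (mu : {measure set T -> \bar R})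
    (f1 f2 : T -> T1) (f : T -> R) :
  measurable_fun setT f1 -> measurable_fun setT f2 ->
  mu.-integrable setT (fun x => (f x)%:E) ->
  mu.-integrable setT (fun x => (f x * s (f1 x) (f2 x))%:E).
Proof.
move=> m1 m2 fi; apply: (@integrableR_bounded _ _ _ _ _ _ M2) => //.
  apply: measurable_funM; first exact: measurable_intble fi.
  exact: measurable_kernel_comp.
by move=> x _; exact: kernel_norm.
Qed.

Lemma integrable_kernel_smooth (L : R -> R) :
  leb.-integrable setT (fun t => (L t)%:E) ->
  leb.-integrable setT (fun z => (\int[leb]_t (s t z * L t))%:E).
Proof.
(* The kernel vanishes unless [z] lies in the interval, so the indicator changes nothing; it makes
   [one z * L t] integrable on the plane. *)
move=> Li; pose one := \1_(`[a, b]%classic) : R -> R.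
pose F (z t : R) := one z * L t * s t z.
have onei : leb.-integrable setT (fun t => (one t)%:E).
  by apply: integrable_indic_itv.
have Fi : (leb \x leb)%E.-integrable setT (fun p => (F p.1 p.2)%:E).
  apply: (@integrable_kernelM _ (T1 * T1)%type _ snd fst) => //.
  exact: integrable_prodM.
have FE z t : F z t = s t z * L t.
  rewrite /F /one indicE mem_setE; have [zab|zab] := boolP (z \in `[a, b]).
    by rewrite mul1r mulrC.
  by rewrite kernel_off ?(negbTE zab) ?andbF// mulr0 mul0r.
have [||Fz _ _] := Fubini_fin Fi.
- by move=> z; apply: (integrable_kernelM (f1 := id)) => //; exact: integrableRZl.
- move=> t; apply: (integrable_kernelM (f2 := id)) => //; exact: integrableRZr.
- apply: eq_integrable Fz => // z _; congr EFin; apply: eq_Rintegral => t _.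
  exact: FE.
Qed.

Lemma kernel_smooth_le (L : R -> R) z :
  leb.-integrable setT (fun t => (L t)%:E) ->
  `|\int[leb]_t (s t z * L t)| <= M2 * \int[leb]_t `|L t|.
Proof.
move=> Li.
have Li' := integrable_norm Li.
have sLi : leb.-integrable setT (fun t => (s t z * L t)%:E).
  under eq_fun do rewrite mulrC.
  exact: (integrable_kernelM (f1 := id)).
apply: le_trans (le_normr_Rintegral measurableT sLi) _.
rewrite -RintegralZl//; apply: le_Rintegral => //.
- exact: integrable_norm sLi.
- exact: integrableRZl.
- by move=> t _ /=; rewrite normrM ler_wpM2r// kernel_norm.
Qed.

End kernel.

(** * Product components with factors bounded away from zero, and their smoothing *)

Section regular_component.
Context (R : realType) (r : nat) (a b : R).
Local Notation leb := (@lebesgue_measure R).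
Local Notation lebr := (@lebesgue_tuple R r).

(** Absorbing [L] into the [k]-th factor leaves a product function. *)
Lemma lebesgue_tuple_marginal (F : 'I_r -> R -> R) (L : R -> R) (k : 'I_r) :
  (forall l, leb.-integrable setT (fun t => (F l t)%:E)) ->
  leb.-integrable setT (fun t => (F k t * L t)%:E) ->
  lebr.-integrable setT
    (fun x => (\prod_(l < r) F l (tnth x l) * L (tnth x k))%:E) /\
  \int[lebr]_x (\prod_(l < r) F l (tnth x l) * L (tnth x k)) =
  (\int[leb]_t (F k t * L t)) * \prod_(l < r | l != k) \int[leb]_t F l t.
Proof.
move=> Fi FLi; pose H l t := F l t * (if l == k then L t else 1).
have HE (l : 'I_r) : l != k -> H l = F l.
  by move=> lk; apply/funext => t; rewrite /H (negbTE lk) mulr1.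
have HkE : H k = fun t => F k t * L t by apply/funext => t; rewrite /H eqxx.
have Hi l : leb.-integrable setT (fun t => (H l t)%:E).
  by have [->|lk] := eqVneq l k; [rewrite HkE|rewrite HE].
have [pi pE] := lebesgue_tuple_prod Hi.
have E (x : r.-tuple R) : \prod_(l < r) H l (tnth x l) =
    \prod_(l < r) F l (tnth x l) * L (tnth x k).
  rewrite (bigD1 k)//= [in RHS](bigD1 k)//= HkE mulrAC; congr (_ * _ * _).
  by apply: eq_bigr => l lk; rewrite HE.
split; first by under eq_fun do rewrite -E.
under eq_Rintegral do rewrite -E.
rewrite pE (bigD1 k)//= HkE; congr (_ * _).
by apply: eq_bigr => l lk; rewrite HE.
Qed.

Lemma ln_prod (I : finType) (F : I -> R) :
  (forall i, 0 < F i) -> ln (\prod_i F i) = \sum_i ln (F i).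
Proof.
move=> F0.
suff [_] : 0 < \prod_i F i /\ ln (\prod_i F i) = \sum_i ln (F i) by [].
apply: (big_ind2 (fun y x => 0 < y /\ ln y = x)) => //; first by rewrite ln1.
by move=> y1 x1 y2 x2 [y10 <-] [y20 <-]; rewrite mulr_gt0// lnM.
Qed.

Lemma in_Omega (x : r.-tuple R) :
  x \in Omega a b <-> forall k, tnth x k \in `[a, b].
Proof. by rewrite inE. Qed.

Lemma notin_Omega (x : r.-tuple R) :
  x \notin Omega a b -> exists k, tnth x k \notin `[a, b].
Proof.
move=> xO; apply: contrapT => nk; move/negP : xO; apply; apply/in_Omega => k.
by apply: contrapT => kab; apply: nk; exists k; exact/negP.
Qed.

Lemma measurable_Omega : measurable (Omega a b : set (r.-tuple R)).
Proof.
rewrite (_ : Omega a b = \bigcap_(i in [set: 'I_r])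
    (fun x : r.-tuple R => tnth x i) @^-1` `[a, b]%classic).
  apply: fin_bigcap_measurable => // i _; rewrite -[X in measurable X]setTI.
  exact: measurable_tnth.
by apply/seteqP; split => x /= xA i => [_|]; exact: xA.
Qed.

(** On the interval [ln c <= ln f <= f], hence [|ln f| <= f + |ln c|]; outside it [f] is 0 and
    [ln 0 = 0]. *)
Lemma integrable_ln (f : R -> R) (c : R) : 0 < c ->
  leb.-integrable setT (fun t => (f t)%:E) ->
  (forall t, if t \in `[a, b] then c <= f t else f t == 0) ->
  leb.-integrable setT (fun t => (ln (f t))%:E).
Proof.
move=> c0 fi fc.
have onei : leb.-integrable setT (fun t => (`|ln c| * \1_(`[a, b]%classic) t)%:E).
  by apply: integrableRZl; apply: integrable_indic_itv.
apply: le_integrableR (integrableRD fi onei).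
  apply: measurableT_comp; first exact: measurable_ln.
  exact: measurable_intble fi.
move=> t; rewrite indicE mem_setE; have := fc t; case: ifPn => tab; last first.
  by move=> /eqP->; rewrite ln0// normr0.
move=> cf; have f0 : 0 < f t by exact: lt_le_trans cf.
rewrite mulr1 [leRHS]ger0_norm; last by rewrite addr_ge0// ltW.
rewrite ler_norml; apply/andP; split.
  apply: (@le_trans _ _ (ln c)); last by rewrite ler_ln.
  rewrite lerNl (le_trans (ler_norm _))// normrN lerDr ltW//.
apply: le_trans (ltW (ln_sublinear f0)) _; rewrite lerDl//.
Qed.

(** The invariant carried along the iterates. The uniform bound [c] is what makes the logarithms of
    the factors integrable; support conditions become plain vanishing outside the interval. *)
Definition regular_component (f : r.-tuple R -> R) (theta c : R)
    (fk : 'I_r -> R -> R) :=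
  [/\ 0 < theta, 0 < c,
      forall k, leb.-integrable setT (fun t => (fk k t)%:E),
      forall k t, if t \in `[a, b] then c <= fk k t else fk k t == 0
    & forall x, f x = theta * \prod_(k < r) fk k (tnth x k)].

Section regular_theory.
Context (f : r.-tuple R -> R) (theta c : R) (fk : 'I_r -> R -> R).
Context (freg : regular_component f theta c fk).

Lemma regular_factor_gt0 k t : t \in `[a, b] -> 0 < fk k t.
Proof.
by case: freg => _ c0 _ /(_ k t) + _ tab; rewrite tab; exact: lt_le_trans.
Qed.

Lemma regular_gt0 x : x \in Omega a b -> 0 < f x.
Proof.
case: freg => theta0 _ _ _ -> /in_Omega xO; rewrite mulr_gt0// prodr_gt0// => k _.
exact: regular_factor_gt0.
Qed.

Lemma regular_off x : x \notin Omega a b -> f x = 0.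
Proof.
case: freg => _ _ _ fk0 -> /notin_Omega[k /negbTE kab].
rewrite (bigD1 k)//=; have := fk0 k (tnth x k); rewrite kab => /eqP->.
by rewrite mul0r mulr0.
Qed.

Lemma integrable_regular : lebr.-integrable setT (fun x => (f x)%:E).
Proof.
case: freg => _ _ fki _ fE; under eq_fun do rewrite fE.
by apply: integrableRZl; have [] := lebesgue_tuple_prod fki.
Qed.

Lemma ln_regular x : x \in Omega a b ->
  ln (f x) = ln theta + \sum_(k < r) ln (fk k (tnth x k)).
Proof.
case: freg => theta0 _ _ _ -> /in_Omega xO.
have fk0 k : 0 < fk k (tnth x k) by exact: regular_factor_gt0.
by rewrite lnM ?ln_prod// posrE prodr_gt0.
Qed.

Lemma integrable_ln_factor k : leb.-integrable setT (fun t => (ln (fk k t))%:E).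
Proof. by case: freg => _ c0 fki fk0 _; exact: integrable_ln (fki k) (fk0 k). Qed.

End regular_theory.

Section smooth_regular.
Context (s : R -> R -> R) (M1 M2 B : R) (sk : smoothing_kernel a b s M1 M2 B).
Context (f : r.-tuple R -> R) (theta c : R) (fk : 'I_r -> R -> R).
Context (freg : regular_component f theta c fk).

Definition smooth_ln_factor k z := \int[leb]_t (s t z * ln (fk k t)).

Lemma prod_kernel_off (x u : r.-tuple R) :
  u \notin Omega a b -> prod_kernel s u x = 0.
Proof.
move=> /notin_Omega[k kab]; rewrite /prod_kernel (bigD1 k)//=.
by rewrite (kernel_off sk) ?(negbTE kab)// mul0r.
Qed.

(** On [Omega], [ln f] is a sum of one-variable functions, and outside it the product kernel
    vanishes. In the [k]-th term the other kernel factors integrate to 1, leaving a one-dimensional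
    smoothing. *)
Lemma smooth_regular x : x \in Omega a b -> smooth s (fun u => ln (f u)) x =
  ln theta + \sum_(k < r) smooth_ln_factor k (tnth x k).
Proof.
move=> /in_Omega xO; rewrite /smooth.
have E u : prod_kernel s u x * ln (f u) = prod_kernel s u x * ln theta +
    \sum_(k < r) prod_kernel s u x * ln (fk k (tnth u k)).
  have [uO|uO] := boolP (u \in Omega a b).
    by rewrite (ln_regular freg)// mulrDr mulr_sumr.
  by rewrite prod_kernel_off// !mul0r add0r big1// => k _; rewrite mul0r.
under eq_Rintegral do rewrite E.
pose F l t := s t (tnth x l).
have Fi l : leb.-integrable setT (fun t => (F l t)%:E).
  exact: (integrable_kernel sk).
have FLi k : leb.-integrable setT (fun t => (F k t * ln (fk k t))%:E).
  under eq_fun do rewrite mulrC.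
  apply: (integrable_kernelM sk (f1 := id)) => //.
  exact: (integrable_ln_factor freg).
have F1 l : \int[leb]_t F l t = 1 by exact: (Rintegral_kernel sk).
have [ki kE] := lebesgue_tuple_prod Fi.
have lam k := lebesgue_tuple_marginal Fi (FLi k).
rewrite RintegralD//; last 2 first.
- by apply: integrableRZr; exact: ki.
- by apply: integrableR_sum => k _; have [] := lam k.
rewrite RintegralZr// kE big1// mul1r; congr (_ + _).
rewrite Rintegral_sum; last by move=> k; have [] := lam k.
apply: eq_bigr => k _; have [_ ->] := lam k.
by rewrite big1 ?mulr1.
Qed.

(** The kernel is at most [M2], so each one-dimensional smoothing is bounded by [M2] times the [L^1]
    norm of [ln (fk k)], uniformly in the point. *)
Lemma smooth_regular_bounded : exists C, forall x, x \in Omega a b ->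
  `|smooth s (fun u => ln (f u)) x| <= C.
Proof.
exists (`|ln theta| + \sum_(k < r) M2 * \int[leb]_t `|ln (fk k t)|) => x xO.
rewrite smooth_regular// (le_trans (ler_normD _ _))// lerD2l.
rewrite (le_trans (ler_norm_sum _ _ _))//; apply: ler_sum => k _.
apply: (kernel_smooth_le sk); exact: (integrable_ln_factor freg).
Qed.

Lemma measurable_smooth_ln_factor k :
  measurable_fun setT (fun x : r.-tuple R => smooth_ln_factor k (tnth x k)).
Proof.
apply: measurableT_comp; last exact: measurable_tnth.
have := integrable_kernel_smooth sk (integrable_ln_factor freg k).
by move/measurable_intble.
Qed.

Lemma measurable_nsmooth : measurable_fun setT (nsmooth a b s f).
Proof.
rewrite (_ : nsmooth a b s f = fun x => if x \in Omega a b then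
    expR (ln theta + \sum_(k < r) smooth_ln_factor k (tnth x k)) else 0).
  apply: measurable_fun_ifT => //.
    apply: (measurable_fun_bool true) => //; rewrite setTI preimage_mem_true.
    exact: measurable_Omega.
  apply: measurableT_comp => //; apply: measurable_funD => //.
  by apply: measurable_sum => k; exact: measurable_smooth_ln_factor.
apply/funext => x; rewrite /nsmooth; case: ifPn => // xO.
by rewrite smooth_regular.
Qed.

End smooth_regular.
End regular_component.

(** * The update of a single component, with [q] standing for [g] times its weight *)

Section mm_step.
Context (R : realType) (r : nat) (a b : R).
Local Notation leb := (@lebesgue_measure R).
Local Notation T1 := (measurableTypeR R).
Local Notation lebr := (@lebesgue_tuple R r).
Context (s : R -> R -> R) (M1 M2 B : R) (sk : smoothing_kernel a b s M1 M2 B).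
Context (q : r.-tuple R -> R) (q0 : forall x, 0 <= q x)
  (qi : lebr.-integrable setT (fun x => (q x)%:E))
  (q_off : forall x, x \notin Omega a b -> q x = 0)
  (W0 : 0 < \int[lebr]_x q x).
Local Notation W := (\int[lebr]_x q x).

Lemma measurable_coord k : measurable_fun setT (fun x : r.-tuple R => tnth x k : T1).
Proof. exact: measurable_tnth. Qed.

Lemma integrable_kernel_coord k t :
  lebr.-integrable setT (fun x => (q x * s t (tnth x k))%:E).
Proof.
exact: (integrable_kernelM sk (@measurable_cst _ _ _ _ setT (t : T1))
  (measurable_coord k) qi).
Qed.

Definition smoothed_marginal k t := \int[lebr]_x (q x * s t (tnth x k)).

(** Fubini moves the smoothing from [L] onto [q]; the joint integrand is integrable because
    [q x * L t] is and the kernel is bounded. *)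
Lemma smoothed_marginal_adjoint k (L : R -> R) :
  leb.-integrable setT (fun t => (L t)%:E) ->
  [/\ lebr.-integrable setT
        (fun x => (q x * \int[leb]_t (s t (tnth x k) * L t))%:E),
      leb.-integrable setT (fun t => (smoothed_marginal k t * L t)%:E) &
      \int[lebr]_x (q x * \int[leb]_t (s t (tnth x k) * L t)) =
      \int[leb]_t (smoothed_marginal k t * L t)].
Proof.
move=> Li.
have sLi x : leb.-integrable setT (fun t => (s t (tnth x k) * L t)%:E).
  under eq_fun do rewrite mulrC.
  exact: (integrable_kernelM sk (f1 := id)).
have qsi t := integrable_kernel_coord k t.
pose F x t := q x * L t * s t (tnth x k).
have F1 x t : F x t = q x * (s t (tnth x k) * L t) by rewrite /F mulrAC -mulrA.
have F2 x t : F x t = q x * s t (tnth x k) * L t by rewrite /F mulrAC.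
have Fi : (lebr \x leb)%E.-integrable setT (fun p => (F p.1 p.2)%:E).
  have m2 : measurable_fun setT (fun p : r.-tuple R * T1 => p.2 : T1).
    exact: measurable_snd.
  have m1 : measurable_fun setT (fun p : r.-tuple R * T1 => tnth p.1 k : T1).
    exact: measurableT_comp (measurable_coord k) measurable_fst.
  exact: (integrable_kernelM sk m2 m1 (integrable_prodM qi Li)).
have [||G1 G2 G3] := Fubini_fin Fi.
- by move=> x; under eq_fun do rewrite F1; exact: integrableRZl.
- by move=> t; under eq_fun do rewrite F2; exact: integrableRZr.
have E1 x : \int[leb]_t F x t = q x * \int[leb]_t (s t (tnth x k) * L t).
  under eq_Rintegral do rewrite F1; rewrite RintegralZl//; exact: sLi.
have E2 t : \int[lebr]_x F x t = smoothed_marginal k t * L t.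
  under eq_Rintegral do rewrite F2; rewrite RintegralZr//; exact: qsi.
split.
- by under eq_fun do rewrite -E1.
- by under eq_fun do rewrite -E2.
- under eq_Rintegral do rewrite -E1; rewrite G3.
  by apply: eq_Rintegral => t _; rewrite E2.
Qed.

Lemma smoothed_marginal_off k t : t \notin `[a, b] -> smoothed_marginal k t = 0.
Proof.
move=> tab; rewrite /smoothed_marginal.
under eq_Rintegral do rewrite (kernel_off sk) ?(negbTE tab)// mulr0.
by rewrite /Rintegral integral0.
Qed.

(** Since [q] lives on [Omega], the kernel is at least [M1] wherever [q] has mass. This recreates
    the lower bound of [regular_component] at each step. *)
Lemma smoothed_marginal_ge k t : t \in `[a, b] -> M1 * W <= smoothed_marginal k t.
Proof.
move=> tab; rewrite -RintegralZl//; apply: le_Rintegral => //.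
- exact: integrableRZl.
- exact: integrable_kernel_coord.
move=> x _; have [/in_Omega xO|/q_off->] := boolP (x \in Omega a b).
  by rewrite mulrC ler_wpM2l//; have /andP[] := kernel_bounds sk tab (xO k).
by rewrite mulr0 mul0r.
Qed.

(** Apply the adjoint relation to the indicator of the interval, whose smoothing equals 1 on the
    interval. *)
Lemma integral_smoothed_marginal k :
  leb.-integrable setT (fun t => (smoothed_marginal k t)%:E) /\
  \int[leb]_t smoothed_marginal k t = W.
Proof.
pose one := \1_(`[a, b]%classic) : R -> R.
have onei : leb.-integrable setT (fun t => (one t)%:E).
  by apply: integrable_indic_itv.
have [_ Ai AE] := smoothed_marginal_adjoint k onei.
have A1 t : smoothed_marginal k t * one t = smoothed_marginal k t.
  rewrite /one indicE mem_setE; have [tab|tab] := boolP (t \in `[a, b]).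
    by rewrite mulr1.
  by rewrite smoothed_marginal_off// mul0r.
split; first by apply: eq_integrable Ai => // t _; rewrite A1.
transitivity (\int[leb]_t (smoothed_marginal k t * one t)).
  by apply: eq_Rintegral => t _; rewrite A1.
rewrite -AE; apply: eq_Rintegral => x _.
have [/in_Omega xO|/q_off->] := boolP (x \in Omega a b); last by rewrite mul0r.
rewrite (_ : \int[leb]_t _ = 1) ?mulr1// -(Rintegral_kernel sk (xO k)).
apply: eq_Rintegral => t _; rewrite /one indicE mem_setE.
have [tab|tab] := boolP (t \in `[a, b]); first by rewrite mulr1.
by rewrite mulr0 (kernel_off sk)// (negbTE tab).
Qed.

(** For [q = g * weight e j] this is [nsmm_step] at index [j]. *)
Definition smoothed_product u :=
  (\prod_(k < r) smoothed_marginal k (tnth u k)) / W ^+ r.-1.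

Lemma smoothed_product_regular : regular_component a b smoothed_product
  (W ^+ r.-1)^-1 (M1 * W) smoothed_marginal.
Proof.
have [M10 _] := kernel_bounds_gt0 sk.
split.
- by rewrite invr_gt0 exprn_gt0.
- exact: mulr_gt0.
- by move=> k; have [] := integral_smoothed_marginal k.
- move=> k t; case: ifPn => tab; first exact: smoothed_marginal_ge.
  exact/eqP/smoothed_marginal_off.
- by move=> x; rewrite mulrC.
Qed.

(** Each of the [r] marginals has mass [W], and the normalization removes [r - 1] of them; [0 < r]
    is what makes [r.-1] a true predecessor. *)
Lemma integral_smoothed_product : (0 < r)%N -> \int[lebr]_u smoothed_product u = W.
Proof.
move=> r0.
have [Pi PE] := lebesgue_tuple_prod (fun k => (integral_smoothed_marginal k).1).
rewrite /smoothed_product RintegralZr// PE.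
rewrite (eq_bigr (fun=> W)) => [|k _]; last by have [] := integral_smoothed_marginal k.
rewrite prodr_const card_ord (_ : W ^+ r = W * W ^+ r.-1); last first.
  by rewrite -exprS prednK.
by rewrite mulfK// expf_neq0// gt_eqF.
Qed.

Section adjoint.
Context (f : r.-tuple R -> R) (theta c : R) (fk : 'I_r -> R -> R).
Context (freg : regular_component a b f theta c fk).

(** Both sides split into a constant term, equal because [smoothed_product] and [q] have the same
    mass, and one term per coordinate, handled by [smoothed_marginal_adjoint]. *)
Lemma smooth_adjoint : (0 < r)%N ->
  [/\ lebr.-integrable setT (fun u => (smoothed_product u * ln (f u))%:E),
      lebr.-integrable setT
        (fun x => (q x * smooth s (fun u => ln (f u)) x)%:E) &
      \int[lebr]_u (smoothed_product u * ln (f u)) =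
      \int[lebr]_x (q x * smooth s (fun u => ln (f u)) x)].
Proof.
move=> r0.
have Li k := integrable_ln_factor freg k.
have adj k := smoothed_marginal_adjoint k (Li k).
have Ai k := (integral_smoothed_marginal k).1.
have ALi k : leb.-integrable setT
    (fun t => (smoothed_marginal k t * ln (fk k t))%:E) by have [] := adj k.
have lam k := lebesgue_tuple_marginal Ai (ALi k).
have pi := integrable_regular smoothed_product_regular.
have E1 u : smoothed_product u * ln (f u) = smoothed_product u * ln theta +
    \sum_(k < r) (\prod_(l < r) smoothed_marginal l (tnth u l) *
                  ln (fk k (tnth u k))) / W ^+ r.-1.
  have [uO|uO] := boolP (u \in Omega a b).
    rewrite (ln_regular freg)// mulrDr mulr_sumr; congr (_ + _).
    by apply: eq_bigr => k _; rewrite mulrAC.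
  rewrite (regular_off smoothed_product_regular)// !mul0r add0r big1// => k _.
  have /notin_Omega[l lab] := uO.
  by rewrite (bigD1 l)//= smoothed_marginal_off// !mul0r.
have E2 x : q x * smooth s (fun u => ln (f u)) x = q x * ln theta +
    \sum_(k < r) q x * smooth_ln_factor s fk k (tnth x k).
  have [xO|xO] := boolP (x \in Omega a b).
    by rewrite (smooth_regular sk freg)// mulrDr mulr_sumr.
  by rewrite q_off// !mul0r add0r big1// => k _; rewrite mul0r.
have I1 k : lebr.-integrable setT
    (fun u => ((\prod_(l < r) smoothed_marginal l (tnth u l) *
                  ln (fk k (tnth u k))) / W ^+ r.-1)%:E).
  by apply: integrableRZr; have [] := lam k.
have I2 k : lebr.-integrable setT
    (fun x => (q x * smooth_ln_factor s fk k (tnth x k))%:E).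
  by have [] := adj k.
split.
- under eq_fun do rewrite E1.
  by apply: integrableRD; [exact: integrableRZr|exact: integrableR_sum].
- under eq_fun do rewrite E2.
  by apply: integrableRD; [exact: integrableRZr|exact: integrableR_sum].
under eq_Rintegral do rewrite E1.
under [RHS]eq_Rintegral do rewrite E2.
rewrite !RintegralD//; [|exact: integrableRZr|exact: integrableR_sum
  |exact: integrableRZr|exact: integrableR_sum].
rewrite RintegralZr// (RintegralZr _ measurableT pi) integral_smoothed_product//.
congr (_ + _).
rewrite !Rintegral_sum//; apply: eq_bigr => k _.
have [lami lamE] := lam k; have [_ _ adjE] := adj k.
rewrite RintegralZr// lamE adjE (eq_bigr (fun=> W)) => [|l _]; last first.
  by have [] := integral_smoothed_marginal l.
(* The [r - 1] other marginals contribute [W ^+ r.-1], which cancels the normalization. *)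
by rewrite prodr_const cardC1 card_ord mulfK// expf_neq0// gt_eqF.
Qed.

End adjoint.
End mm_step.

(** * Additivity of the integral when one summand may have integral +oo *)

Section integralD_lower.
Context d (T : measurableType d) (R : realType).
Context (mu : {measure set T -> \bar R}).

(** If [F] has infinite integral, so has the positive part of [F + h], because [F] is at most that
    part plus [|h|]; the negative part is dominated by [|h|]. *)
Lemma ge0_integralD_EFin (F h : T -> R) :
  measurable_fun setT F -> (forall x, 0 <= F x) ->
  mu.-integrable setT (fun x => (h x)%:E) ->
  (\int[mu]_x (F x + h x)%:E = \int[mu]_x (F x)%:E + \int[mu]_x (h x)%:E)%E.
Proof.
move=> mF F0 hi.
have mF' : measurable_fun setT (fun x => (F x)%:E) by exact/measurable_EFinP.
have mh := measurable_intble hi.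
have hN : (\int[mu]_x `|(h x)%:E| < +oo)%E by have /integrableP[] := hi.
have mhN : measurable_fun setT (fun x => `|(h x)%:E|)%E.
  by apply: measurableT_comp => //; exact/measurable_EFinP.
have hl x : - `|h x| <= h x by rewrite lerNl -normrN ler_norm.
have [Foo|Foo] := ltP (\int[mu]_x (F x)%:E)%E +oo%E.
  rewrite -integralD//; apply/integrableP; split=> //.
  by under eq_integral do rewrite gee0_abs ?lee_fin//.
have {}Foo : (\int[mu]_x (F x)%:E = +oo)%E by apply/eqP; rewrite -leye_eq.
pose G x := (F x + h x)%:E.
have mG : measurable_fun setT G by apply/measurable_EFinP; exact: measurable_funD.
have hfin := integrable_fin_num measurableT hi.
rewrite Foo addye; last by move: hfin; rewrite fin_numE => /andP[].
rewrite [LHS]integralE.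
have Gneg : (\int[mu]_x G^\- x < +oo)%E.
  apply: le_lt_trans hN; apply: ge0_le_integral => //.
  - exact: measurable_funeneg.
  - move=> x _; rewrite funenegE ge_max abse_ge0 andbT lee_fin lerNl.
    by apply: le_trans (hl x) _; rewrite lerDr.
have -> : (\int[mu]_x G^\+ x = +oo)%E.
  apply/eqP; rewrite -leye_eq leNgt; apply/negP => Gpos.
  suff : (+oo < +oo :> \bar R)%E by rewrite ltxx.
  rewrite -{1}Foo.
  apply: (@le_lt_trans _ _ (\int[mu]_x (G^\+ x + `|(h x)%:E|))%E); last first.
    rewrite ge0_integralD//; [exact: lte_add_pinfty|exact: measurable_funepos].
  apply: ge0_le_integral => //.
  - by move=> x _; rewrite lee_fin.
  - by apply: emeasurable_funD => //; exact: measurable_funepos.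
  - move=> x _; rewrite funeposE -leeBlDr// le_max -EFinB lee_fin.
    by rewrite lerD2l hl.
by rewrite addye// gt_eqF// lteNr.
Qed.

(** Adding [phi] reduces to a nonnegative function. The intended [f] is [g * ln (g / mass)], which
    is bounded below by an integrable function but need not be integrable. *)
Lemma integralD_lower (f phi h : T -> R) :
  measurable_fun setT f -> (forall x, - phi x <= f x) ->
  mu.-integrable setT (fun x => (phi x)%:E) ->
  mu.-integrable setT (fun x => (h x)%:E) ->
  (\int[mu]_x (f x + h x)%:E = \int[mu]_x (f x)%:E + (\int[mu]_x h x)%:E)%E.
Proof.
move=> mf fphi phii hi.
have mF : measurable_fun setT (fun x => f x + phi x).
  by apply: measurable_funD => //; exact: measurable_intble phii.
have F0 x : 0 <= f x + phi x by rewrite -lerBlDr sub0r.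
have E0 x : (f x)%:E = ((f x + phi x) + - phi x)%:E by rewrite addrK.
have E1 x : (f x + h x)%:E = ((f x + phi x) + (h x - phi x))%:E.
  by rewrite addrACA subrr addr0.
have Ni : mu.-integrable setT (fun x => (- phi x)%:E).
  by under eq_fun do rewrite -mulN1r; exact: integrableRZl.
rewrite (eq_integral _ _ (fun x _ => E0 x)) (eq_integral _ _ (fun x _ => E1 x)).
rewrite (ge0_integralD_EFin mF F0 Ni).
rewrite (ge0_integralD_EFin mF F0 (integrableRB hi phii)).
rewrite -addeA; congr (_ + _)%E.
rewrite -(EFin_Rintegral Ni) -(EFin_Rintegral (integrableRB hi phii)) -EFinD.
by rewrite -RintegralD//; under [in RHS]eq_Rintegral do rewrite addrC.
Qed.

End integralD_lower.

(** * Positivity, bounds and measurability of the weights *)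

Section weights.
Context (R : realType) (r m : nat) (a b : R).
Local Notation leb := (@lebesgue_measure R).
Local Notation lebr := (@lebesgue_tuple R r).
Context (s : R -> R -> R) (M1 M2 B : R) (sk : smoothing_kernel a b s M1 M2 B).
Implicit Types e : 'I_m -> r.-tuple R -> R.

Definition regular_family e :=
  forall j, exists theta c fk, regular_component a b (e j) theta c fk.

Lemma nsmooth_gt0 (f : r.-tuple R -> R) x : x \in Omega a b -> 0 < nsmooth a b s f x.
Proof. by move=> xO; rewrite /nsmooth xO expR_gt0. Qed.

Lemma nsmooth_ge0 (f : r.-tuple R -> R) x : 0 <= nsmooth a b s f x.
Proof. by rewrite /nsmooth; case: ifPn => // _; exact: expR_ge0. Qed.

Lemma nsmooth_sum_gt0 e x : (0 < m)%N -> x \in Omega a b ->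
  0 < \sum_(j < m) nsmooth a b s (e j) x.
Proof.
move=> m0 xO; rewrite (bigD1 (Ordinal m0))//= ltr_pwDl ?nsmooth_gt0//.
by apply: sumr_ge0 => j _; exact: nsmooth_ge0.
Qed.

Lemma weight_ge0 e j x : 0 <= weight a b s e j x.
Proof.
by rewrite divr_ge0 ?nsmooth_ge0// sumr_ge0// => k _; exact: nsmooth_ge0.
Qed.

Lemma weight_gt0 e j x : x \in Omega a b -> 0 < weight a b s e j x.
Proof.
move=> xO; rewrite divr_gt0 ?nsmooth_gt0// nsmooth_sum_gt0//.
exact: leq_ltn_trans (ltn_ord j).
Qed.

Lemma sum_weight e x : (0 < m)%N -> x \in Omega a b ->
  \sum_(j < m) weight a b s e j x = 1.
Proof.
by move=> m0 xO; rewrite -mulr_suml divff// gt_eqF// nsmooth_sum_gt0.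
Qed.

Lemma weight_le1 e j x : weight a b s e j x <= 1.
Proof.
have m0 : (0 < m)%N by exact: leq_ltn_trans (ltn_ord j).
have [xO|xO] := boolP (x \in Omega a b); last first.
  by rewrite /weight {1}/nsmooth (negbTE xO) mul0r.
rewrite -(sum_weight e m0 xO) (bigD1 j)//= lerDl sumr_ge0// => k _.
exact: weight_ge0.
Qed.

Lemma ln_weight e j x : x \in Omega a b -> ln (weight a b s e j x) =
  smooth s (fun u => ln (e j u)) x - ln (\sum_(i < m) nsmooth a b s (e i) x).
Proof.
move=> xO; rewrite /weight ln_div ?posrE ?nsmooth_gt0//; last first.
  by apply: nsmooth_sum_gt0 => //; exact: leq_ltn_trans (ltn_ord j).
by rewrite {1}/nsmooth xO expRK.
Qed.

Section regular.
Context (e : 'I_m -> r.-tuple R -> R) (ereg : regular_family e).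

Lemma measurable_nsmooth_sum :
  measurable_fun setT (fun x => \sum_(j < m) nsmooth a b s (e j) x).
Proof.
apply: measurable_sum => j; have [theta [c [fk freg]]] := ereg j.
exact: (measurable_nsmooth sk freg).
Qed.

Lemma measurable_weight j : measurable_fun setT (weight a b s e j).
Proof.
have [theta [c [fk freg]]] := ereg j.
(* Writing the reciprocal as [expR (- ln _)] exhibits measurability by composition; off [Omega] the
   numerator is 0 on both sides. *)
rewrite (_ : weight a b s e j = fun x => nsmooth a b s (e j) x *
    expR (- ln (\sum_(i < m) nsmooth a b s (e i) x))); last first.
  apply/funext => x; have [xO|xO] := boolP (x \in Omega a b); last first.
    by rewrite /weight {1 3}/nsmooth (negbTE xO) !mul0r.
  rewrite expRN lnK// posrE nsmooth_sum_gt0//; exact: leq_ltn_trans (ltn_ord j).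
apply: measurable_funM; first exact: (measurable_nsmooth sk freg).
apply: measurableT_comp => //; apply: measurableT_comp => //.
by apply: measurableT_comp measurable_nsmooth_sum; exact: measurable_ln.
Qed.

Lemma nsmooth_bounds : exists C, forall j x, x \in Omega a b ->
  expR (- C) <= nsmooth a b s (e j) x <= expR C.
Proof.
have /choice[C CP] j : exists C, forall x, x \in Omega a b ->
    `|smooth s (fun u => ln (e j u)) x| <= C.
  have [theta [c [fk freg]]] := ereg j; exact: (smooth_regular_bounded sk freg).
(* The sum of absolute values dominates every [C j], giving one constant for all components. *)
exists (\sum_j `|C j|) => j x xO; rewrite /nsmooth xO !ler_expR -ler_norml.
rewrite (le_trans (CP j x xO))// (bigD1 j)//= (le_trans (ler_norm _))// lerDl.
exact: sumr_ge0.
Qed.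

Lemma ln_nsmooth_sum_bounded : (0 < m)%N -> exists C, forall x, x \in Omega a b ->
  `|ln (\sum_(j < m) nsmooth a b s (e j) x)| <= C.
Proof.
move=> m0; have [C CP] := nsmooth_bounds.
(* From above, [m] terms of size at most [expR C] give [C + ln m]. From below a single term gives
   [- C], and [ln m >= 0] lets the same constant serve. *)
exists (C + ln m%:R) => x xO.
have S0 := nsmooth_sum_gt0 e m0 xO.
have lnm : 0 <= ln (m%:R : R) by rewrite ln_ge0// ler1n.
rewrite ler_norml; apply/andP; split.
  apply: (@le_trans _ _ (- C)); first by rewrite lerN2 lerDl.
  rewrite -[leLHS]expRK ler_ln ?posrE ?expR_gt0//.
  have /andP[+ _] := CP (Ordinal m0) x xO; move/le_trans; apply.
  rewrite (bigD1 (Ordinal m0))//= lerDl sumr_ge0// => j _; exact: nsmooth_ge0.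
rewrite -[C]expRK -lnM ?posrE ?expR_gt0 ?ltr0n// ler_ln ?posrE//; last first.
  by rewrite mulr_gt0 ?expR_gt0 ?ltr0n.
rewrite mulr_natr -[m in leRHS]card_ord -sumr_const ler_sum// => j _.
by have /andP[] := CP j x xO.
Qed.

(** Dominated by a multiple of the indicator of [Omega], a product of coordinate indicators. It
    provides the lower bound needed by [integralD_lower]. *)
Lemma integrable_nsmooth_sum : lebr.-integrable setT
  (fun x => (\sum_(j < m) nsmooth a b s (e j) x)%:E).
Proof.
have [C CP] := nsmooth_bounds.
pose one := \1_(`[a, b]%classic) : R -> R.
have onei : leb.-integrable setT (fun t => (one t)%:E).
  by apply: integrable_indic_itv.
have [oi _] := lebesgue_tuple_prod (fun k : 'I_r => onei).
apply: le_integrableR (integrableRZl (\sum_(j < m) expR C) oi).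
  exact: measurable_nsmooth_sum.
move=> x.
have [xO|xO] := boolP (x \in Omega a b); last first.
  by rewrite big1 ?normr0// => j _; rewrite /nsmooth (negbTE xO).
rewrite [X in _ * X]big1 ?mulr1 => [|k _]; last first.
  by rewrite /one indicE mem_setE; move/in_Omega : xO => ->.
rewrite (le_trans (ler_norm_sum _ _ _))// ger0_norm; last first.
  by apply: sumr_ge0 => j _; exact: expR_ge0.
apply: ler_sum => j _; rewrite ger0_norm ?nsmooth_ge0//.
by have /andP[] := CP j x xO.
Qed.

End regular.
End weights.

(** * Change of the objective over one step *)

Section descent.
Context (R : realType) (r m : nat) (a b : R).
Local Notation leb := (@lebesgue_measure R).
Local Notation lebr := (@lebesgue_tuple R r).
Context (s : R -> R -> R) (M1 M2 B : R) (sk : smoothing_kernel a b s M1 M2 B).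
Context (g : r.-tuple R -> R) (g_density : density g)
  (g_off : forall x, x \notin Omega a b -> g x = 0)
  (r0 : (0 < r)%N) (m0 : (0 < m)%N).
Implicit Types e : 'I_m -> r.-tuple R -> R.

Local Notation g_weight e j := (fun x => g x * weight a b s e j x).
Local Notation mass e := (fun x => \sum_(j < m) nsmooth a b s (e j) x).

Let g0 x : 0 <= g x. Proof. by case: g_density. Qed.

Lemma g_neq0 x : g x != 0 -> x \in Omega a b.
Proof. by move=> gx0; apply: contraNT gx0 => /g_off->; exact: eqxx. Qed.

Lemma integrable_density : lebr.-integrable setT (fun x => (g x)%:E).
Proof.
case: g_density => mg _ g1; apply/integrableP; split; first exact/measurable_EFinP.
by under eq_integral do rewrite gee0_abs ?lee_fin//; rewrite g1 ltry.
Qed.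

Lemma Rintegral_density : \int[lebr]_x g x = 1.
Proof. by case: g_density => _ _ g1; rewrite /Rintegral g1. Qed.

(** Here [d] is any function equal to the log-ratio where [f1] is nonzero. Since [f2] is nonzero
    there too, the value +oo of [xlnx_ratio] never occurs and the divergence is a real number. *)
Lemma KL_Rintegral (f1 f2 d : r.-tuple R -> R) :
  lebr.-integrable setT (fun x => (f1 x)%:E) ->
  lebr.-integrable setT (fun x => (f2 x)%:E) ->
  lebr.-integrable setT (fun x => (f1 x * d x)%:E) ->
  (forall x, f1 x != 0 -> f2 x != 0 /\ ln (f1 x / f2 x) = d x) ->
  KL f1 f2 = (\int[lebr]_x (f1 x * d x) + \int[lebr]_x f2 x - \int[lebr]_x f1 x)%:E.
Proof.
move=> i1 i2 id fd.
have i12 := integrableRD id i2.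
rewrite -RintegralD// -RintegralB// EFin_Rintegral; last exact: integrableRB.
apply: eq_integral => x _; rewrite /xlnx_ratio.
have [->|f1x] := eqVneq (f1 x) 0; first by rewrite mul0r !add0r.
by have [/negbTE -> ->] := fd x f1x.
Qed.

Section regular.
Context (e : 'I_m -> r.-tuple R -> R) (ereg : regular_family a b e).

Lemma g_weight_ge0 j x : 0 <= g x * weight a b s e j x.
Proof. by rewrite mulr_ge0// weight_ge0. Qed.

Lemma g_weight_off j x : x \notin Omega a b -> g x * weight a b s e j x = 0.
Proof. by move=> xO; rewrite g_off// mul0r. Qed.

Lemma integrable_g_weight j : lebr.-integrable setT (fun x => (g_weight e j x)%:E).
Proof.
apply: (@integrableR_bounded _ _ _ _ _ _ 1); first exact: integrable_density.
  apply: measurable_funM; first by case: g_density.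
  exact: (measurable_weight sk).
by move=> x _; rewrite ger0_norm ?weight_le1// weight_ge0.
Qed.

Lemma sum_g_weight x : \sum_(j < m) g x * weight a b s e j x = g x.
Proof.
rewrite -mulr_sumr; have [xO|xO] := boolP (x \in Omega a b).
  by rewrite sum_weight// mulr1.
by rewrite g_off// mul0r.
Qed.

Lemma Rintegral_g_weight_gt0 j : 0 < \int[lebr]_x (g_weight e j x).
Proof.
have [theta [c [fk freg]]] := ereg j.
have [C1 C1P] := smooth_regular_bounded sk freg.
have [C2 C2P] := ln_nsmooth_sum_bounded sk ereg m0.
(* [C1] bounds the smoothed logarithm and [C2] the logarithm of the total mass, so the weight is at
   least [delta] on [Omega], while [g] integrates to 1. *)
pose delta := expR (- (C1 + C2)).
apply: (@lt_le_trans _ _ (\int[lebr]_x (delta * g x))).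
  by rewrite RintegralZl ?Rintegral_density ?mulr1 ?expR_gt0//; exact: integrable_density.
apply: le_Rintegral => //.
- exact: integrableRZl integrable_density.
- exact: integrable_g_weight.
move=> x _; have [xO|/g_off->] := boolP (x \in Omega a b); last by rewrite mul0r mulr0.
rewrite mulrC ler_wpM2l// -[leRHS]lnK ?posrE ?weight_gt0// ler_expR ln_weight//.
rewrite opprD lerB//.
  by have := C1P x xO; rewrite ler_norml => /andP[].
by have := C2P x xO; rewrite ler_norml => /andP[].
Qed.

Lemma nsmm_step_regular : regular_family a b (fun j => nsmm_step a b s g e j).
Proof.
move=> j; do 3 eexists; exact: (smoothed_product_regular sk (g_weight_ge0 j)
  (integrable_g_weight j) (g_weight_off j) (Rintegral_g_weight_gt0 j)).
Qed.

Lemma integrable_g_ln_mass :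
  lebr.-integrable setT (fun x => (g x * ln (mass e x))%:E).
Proof.
have [C CP] := ln_nsmooth_sum_bounded sk ereg m0.
apply: (@integrableR_bounded _ _ _ _ _ _ C); first exact: integrable_density.
  apply: measurable_funM; first by case: g_density.
  apply: measurableT_comp (measurable_nsmooth_sum sk ereg); exact: measurable_ln.
by move=> x /g_neq0; exact: CP.
Qed.

(** Only the entropy integral stays in the extended reals. Where [g] is nonzero the point lies in
    [Omega], so the denominator is positive and no infinite integrand occurs. *)
Lemma objective_relative_entropy :
  (objective a b s g e = \int[lebr]_x (g x * ln (g x / mass e x))%:E +
     (\sum_(j < m) \int[lebr]_x e j x)%:E)%E.
Proof.
congr (_ + _)%E.
  apply: eq_integral => x _; rewrite /xlnx_ratio.
  have [->|gx0] := eqVneq (g x) 0; first by rewrite mul0r.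
  have xO := g_neq0 gx0.
  by rewrite gt_eqF// nsmooth_sum_gt0.
have ei j : lebr.-integrable setT (fun x => (e j x)%:E).
  by have [theta [c [fk freg]]] := ereg j; exact: (integrable_regular freg).
rewrite -Rintegral_sum// EFin_Rintegral//; exact: integrableR_sum.
Qed.

End regular.

Lemma mulr_ln_div (y u v : R) : 0 <= y -> (y != 0 -> 0 < u /\ 0 < v) ->
  y * ln (y / u) = y * ln (y / v) + y * (ln v - ln u).
Proof.
move=> y0; have [->|yN0 /(_ isT)[u0 v0]] := eqVneq y 0; first by rewrite !mul0r addr0.
have y1 : 0 < y by rewrite lt_neqAle eq_sym yN0.
by rewrite !ln_div// -mulrDr addrA subrK.
Qed.

Lemma ln_div_mull (y u v : R) : y != 0 -> 0 < u -> 0 < v ->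
  ln ((y * u) / (y * v)) = ln u - ln v.
Proof. by move=> y0 u0 v0; rewrite -mulf_div divff// mul1r ln_div. Qed.

(** * Comparison of two regular families, the second one eventually the NSMM image of the first *)

Section comparison.
Context (e1 e2 : 'I_m -> r.-tuple R -> R).
Context (e1reg : regular_family a b e1) (e2reg : regular_family a b e2).

(** Both entropies may be +oo, but they differ by the integral of a bounded multiple of [g], which
    [integralD_lower] splits off. *)
Lemma relative_entropy_change :
  (\int[lebr]_x (g x * ln (g x / mass e1 x))%:E =
   \int[lebr]_x (g x * ln (g x / mass e2 x))%:E +
   (\int[lebr]_x (g x * (ln (mass e2 x) - ln (mass e1 x))))%:E)%E.
Proof.
have i1 := integrable_g_ln_mass e1reg; have i2 := integrable_g_ln_mass e2reg.
have hi : lebr.-integrable setT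
    (fun x => (g x * (ln (mass e2 x) - ln (mass e1 x)))%:E).
  by apply: eq_integrable (integrableRB i2 i1) => // x _; rewrite [in RHS]mulrBr.
have gE x : g x * ln (g x / mass e2 x) = g x * (ln (g x) - ln (mass e2 x)).
  have [->|gx0] := eqVneq (g x) 0; first by rewrite !mul0r.
  by rewrite ln_div// posrE ?nsmooth_sum_gt0 ?g_neq0// lt_neqAle eq_sym gx0 g0.
rewrite -(integralD_lower _ _ (integrable_nsmooth_sum sk e2reg) hi).
- apply: eq_integral => x _; congr EFin; apply: mulr_ln_div => // gx0.
  by split; exact: nsmooth_sum_gt0 (g_neq0 gx0).
- under eq_fun do rewrite gE.
  have mg : measurable_fun setT g by case: g_density.
  apply: measurable_funM => //; apply: measurable_funB.
    by apply: measurableT_comp mg; exact: measurable_ln.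
  apply: measurableT_comp (measurable_nsmooth_sum sk e2reg); exact: measurable_ln.
move=> x; have [gx0|gx0] := eqVneq (g x) 0.
  by rewrite gx0 mul0r oppr_le0 sumr_ge0// => j _; exact: nsmooth_ge0.
have xO := g_neq0 gx0.
have gx : 0 < g x by rewrite lt_neqAle eq_sym gx0 g0.
have S0 := nsmooth_sum_gt0 s e2 m0 xO.
(* With [t = mass e2 x / g x], the inequality [ln t <= t] gives
   [g * ln (g / mass e2) >= - mass e2]. *)
rewrite -invf_div lnV ?posrE ?divr_gt0// mulrN lerN2 mulrC -ler_pdivlMr//.
by rewrite ltW// ln_sublinear// divr_gt0.
Qed.

Lemma KL_weight j :
  lebr.-integrable setT (fun x => (g x * weight a b s e1 j x *
    (ln (weight a b s e1 j x) - ln (weight a b s e2 j x)))%:E) ->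
  KL (g_weight e1 j) (g_weight e2 j) =
  (\int[lebr]_x (g x * weight a b s e1 j x *
     (ln (weight a b s e1 j x) - ln (weight a b s e2 j x))) +
   \int[lebr]_x (g_weight e2 j x) - \int[lebr]_x (g_weight e1 j x))%:E.
Proof.
move=> di; apply: (KL_Rintegral (integrable_g_weight e1reg j)
  (integrable_g_weight e2reg j) di) => x qx0.
have gx0 : g x != 0 by apply: contraNneq qx0 => ->; rewrite mul0r.
have w1 := weight_gt0 s e1 j (g_neq0 gx0).
have w2 := weight_gt0 s e2 j (g_neq0 gx0).
split; first by rewrite mulf_neq0// gt_eqF.
exact: ln_div_mull.
Qed.

Lemma KL_component j :
  lebr.-integrable setT (fun x => (e2 j x * (ln (e2 j x) - ln (e1 j x)))%:E) ->
  KL (e2 j) (e1 j) = (\int[lebr]_x (e2 j x * (ln (e2 j x) - ln (e1 j x))) +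
   \int[lebr]_x e1 j x - \int[lebr]_x e2 j x)%:E.
Proof.
have [theta1 [c1 [fk1 freg1]]] := e1reg j; have [theta2 [c2 [fk2 freg2]]] := e2reg j.
move=> di; apply: (KL_Rintegral (integrable_regular freg2) (integrable_regular freg1) di).
move=> x ex0.
have xO : x \in Omega a b.
  by apply: contraNT ex0 => xO; rewrite (regular_off freg2).
have f1 := regular_gt0 freg1 xO; have f2 := regular_gt0 freg2 xO.
by rewrite ln_div// gt_eqF.
Qed.

Context (e2E : e2 = (fun j => nsmm_step a b s g e1 j)).

(** Apply [smooth_adjoint] to [e2 j] and to [e1 j] with the same [q], namely [g] times the weight of
    [e1], and subtract. *)
Lemma component_adjoint j :
  [/\ lebr.-integrable setT (fun x => (e2 j x * (ln (e2 j x) - ln (e1 j x)))%:E),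
      lebr.-integrable setT (fun x => (g x * weight a b s e1 j x *
        (smooth s (fun u => ln (e2 j u)) x - smooth s (fun u => ln (e1 j u)) x))%:E) &
      \int[lebr]_x (e2 j x * (ln (e2 j x) - ln (e1 j x))) =
      \int[lebr]_x (g x * weight a b s e1 j x *
        (smooth s (fun u => ln (e2 j u)) x - smooth s (fun u => ln (e1 j u)) x))].
Proof.
have [theta1 [c1 [fk1 freg1]]] := e1reg j; have [theta2 [c2 [fk2 freg2]]] := e2reg j.
have adj f theta c fk (freg : regular_component a b f theta c fk) :=
  smooth_adjoint sk (g_weight_ge0 e1 j) (integrable_g_weight e1reg j)
    (g_weight_off e1 j) (Rintegral_g_weight_gt0 e1reg j) freg r0.
have [i1 k1 E1] := adj _ _ _ _ freg1; have [i2 k2 E2] := adj _ _ _ _ freg2.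
have eE : smoothed_product s (g_weight e1 j) = e2 j by rewrite e2E.
rewrite eE in i1 i2 E1 E2.
split.
- by apply: eq_integrable (integrableRB i2 i1) => // x _; rewrite [in RHS]mulrBr.
- by apply: eq_integrable (integrableRB k2 k1) => // x _; rewrite [in RHS]mulrBr.
transitivity (\int[lebr]_x (e2 j x * ln (e2 j x) - e2 j x * ln (e1 j x))).
  by apply: eq_Rintegral => x _; rewrite mulrBr.
rewrite RintegralB// E1 E2 -RintegralB//.
by apply: eq_Rintegral => x _; rewrite [in RHS]mulrBr.
Qed.

Let change_integrand j x := g x * weight a b s e1 j x * (ln (mass e2 x) - ln (mass e1 x)).

Let integrable_change j : lebr.-integrable setT (fun x => (change_integrand j x)%:E).
Proof.
have i1 := integrable_g_ln_mass e1reg; have i2 := integrable_g_ln_mass e2reg.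
have mw : measurable_fun setT (weight a b s e1 j) by exact: (measurable_weight sk).
have i0 := integrableRB i2 i1.
have E x : change_integrand j x =
    (g x * ln (mass e2 x) - g x * ln (mass e1 x)) * weight a b s e1 j x.
  by rewrite -mulrBr mulrAC.
under eq_fun do rewrite E.
apply: (@integrableR_bounded _ _ _ _ _ _ 1) => //.
  by apply: measurable_funM => //; exact: measurable_intble i0.
by move=> x _; rewrite ger0_norm ?weight_le1// weight_ge0.
Qed.

Let change_split j x : g x * weight a b s e1 j x *
     (ln (weight a b s e1 j x) - ln (weight a b s e2 j x)) =
  change_integrand j x - g x * weight a b s e1 j x *
     (smooth s (fun u => ln (e2 j u)) x - smooth s (fun u => ln (e1 j u)) x).
Proof.
rewrite -[RHS]mulrBr; have [xO|/g_off->] := boolP (x \in Omega a b); last first.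
  by rewrite !mul0r.
have alg (t1 t2 u1 u2 : R) : (t1 - u1) - (t2 - u2) = (u2 - u1) - (t2 - t1) by ring.
by rewrite (ln_weight s e1 j xO) (ln_weight s e2 j xO) alg.
Qed.

Lemma relative_entropy_decrease :
  \int[lebr]_x (g x * (ln (mass e2 x) - ln (mass e1 x))) =
  \sum_(j < m) (\int[lebr]_x (e2 j x * (ln (e2 j x) - ln (e1 j x))) +
    \int[lebr]_x (g x * weight a b s e1 j x *
     (ln (weight a b s e1 j x) - ln (weight a b s e2 j x)))).
Proof.
(* The weights of [e1] sum to 1 wherever [g] is nonzero, so they can be inserted under the
   integral. *)
transitivity (\int[lebr]_x (\sum_(j < m) change_integrand j x)).
  by apply: eq_Rintegral => x _; rewrite -mulr_suml sum_g_weight.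
rewrite Rintegral_sum//; apply: eq_bigr => j _.
have [_ i2 ->] := component_adjoint j.
rewrite (eq_Rintegral _ (fun x _ => change_split j x)).
rewrite (RintegralB measurableT (integrable_change j) i2).
by rewrite addrC subrK.
Qed.

Lemma objective_decrease :
  (objective a b s g e1 = objective a b s g e2 +
   (\sum_(j < m) KL (e2 j) (e1 j) +
    \sum_(j < m) KL (g_weight e1 j) (g_weight e2 j)))%E /\
  (\sum_(j < m) KL (e2 j) (e1 j) +
    \sum_(j < m) KL (g_weight e1 j) (g_weight e2 j))%E \is a fin_num.
Proof.
have wi j : lebr.-integrable setT (fun x => (g x * weight a b s e1 j x *
    (ln (weight a b s e1 j x) - ln (weight a b s e2 j x)))%:E).
  have [_ i2 _] := component_adjoint j.
  under eq_fun do rewrite change_split.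
  exact: integrableRB.
under eq_bigr => j _ do
  (rewrite KL_component; last by have [] := component_adjoint j).
under [X in (_ + (_ + X))%E]eq_bigr do rewrite KL_weight//.
under [X in (_ + X)%E \is a fin_num]eq_bigr do rewrite KL_weight//.
rewrite !sumEFin; split => //.
have l1 := etrans (objective_relative_entropy e1reg)
  (congr1 (fun z => (z + _)%E) relative_entropy_change).
rewrite l1 (objective_relative_entropy e2reg).
rewrite relative_entropy_decrease.
(* The only possibly infinite term is common to both sides; once it is generalized, an identity
   between real numbers remains. *)
move: (\int[lebr]_x (g x * ln (g x / mass e2 x))%:E)%E => relative_entropy2.
rewrite -!addeA -!EFinD; congr (_ + _%:E)%E.
have sumq e (ereg : regular_family a b e) :
    \sum_(j < m) \int[lebr]_x (g_weight e j x) = 1.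
  rewrite -Rintegral_sum => [|j]; last exact: integrable_g_weight.
  by under eq_Rintegral do rewrite sum_g_weight; rewrite Rintegral_density.
(* The linear terms of the weight divergences cancel in total, as both weighted families have mass
   1; those of the component divergences account for the change of total component mass. *)
have alg (A A' E1 E2 Q1 Q2 : 'I_m -> R) : \sum_i Q1 i = \sum_i Q2 i ->
    \sum_i (A i + A' i) + \sum_i E1 i =
    \sum_i E2 i + (\sum_i (A i + E1 i - E2 i) + \sum_i (A' i + Q2 i - Q1 i)).
  by rewrite !big_split/= !sumrN => ->; ring.
apply: alg.
exact: etrans (sumq _ e1reg) (esym (sumq _ e2reg)).
Qed.

End comparison.

End descent.

(** * Regularity of the starting point *)

Section initial_data.
Context (R : realType) (r : nat) (a b : R).
Local Notation leb := (@lebesgue_measure R).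
Local Notation lebr := (@lebesgue_tuple R r).

Lemma density_off (g : r.-tuple R -> R) : support_in_interior_Omega a b g ->
  forall x, x \notin Omega a b -> g x = 0.
Proof.
(* The support condition lives on row vectors, so the tuple is transported to one. *)
move=> gs x xO; pose y : 'rV[R]_r := \row_k tnth x k.
have yx : row_point y = x.
  by apply: eq_from_tnth => k; rewrite tnth_mktuple mxE.
rewrite -yx; apply: (fsupportP (f := g \o @row_point R r) gs) => /interior_subset.
by rewrite /preimage/= yx; move/mem_set => xO'; rewrite xO' in xO.
Qed.

(** Freezing all coordinates but the [k]-th at [a] turns the lower bound on the normalized product
    into a lower bound on the single factor [fk k]. *)
Lemma product_component_regular (f : r.-tuple R -> R) (M : R) :
  (0 < r)%N -> a < b -> 0 < M ->
  product_component a b f -> component_lower_bound a b M f ->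
  exists theta c fk, regular_component a b f theta c fk.
Proof.
move=> r0 ab M0 [theta [fk [theta0 fkP fE]]] lb.
have fki k : leb.-integrable setT (fun t => (fk k t)%:E) by have [] := fkP k.
have fk0 k t : t \in `[a, b] -> 0 < fk k t by have [_ + _] := fkP k; exact.
have fk_off k t : t \notin `[a, b] -> fk k t = 0.
  by move=> tab; have [_ _ fs] := fkP k; apply: (fsupportP fs) => /=; exact/negP.
have fk_ge0 k t : 0 <= fk k t.
  by have [/(fk0 k)/ltW//|/(fk_off k)->] := boolP (t \in `[a, b]).
have aab : a \in `[a, b] by rewrite in_itv/= lexx ltW.
have I0 : 0 <= \int[lebr]_z f z.
  by apply: Rintegral_ge0 => x _; rewrite fE mulr_ge0 ?(ltW theta0)// prodr_ge0.
have Ipos : 0 < \int[lebr]_z f z.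
  (* Were the integral 0, the quotient in [lb] would be 0 by the convention for division, against
     the positive bound at the corner [(a, ..., a)]. *)
  rewrite lt_neqAle eq_sym I0 andbT; apply/eqP => I00.
  have aO : [tuple a | _ < r] \in Omega a b by apply/in_Omega => k; rewrite tnth_mktuple.
  have := lb _ aO; rewrite I00 invr0 mulr0 => /(lt_le_trans (exprn_gt0 r M0)).
  by rewrite ltxx.
(* With the other coordinates at [a], [f] equals [fk k t * P k]. Bounding every [P k] by their sum
   [Q] makes the constant [d / Q] independent of [k]. *)
pose P k := theta * \prod_(l < r | l != k) fk l a.
have P0 k : 0 < P k by rewrite mulr_gt0// prodr_gt0// => l _; exact: fk0.
pose Q := \sum_k P k.
have PQ k : P k <= Q.
  by rewrite /Q (bigD1 k)//= lerDl sumr_ge0// => l _; exact: ltW.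
have Q0 : 0 < Q by apply: lt_le_trans (PQ (Ordinal r0)).
pose d := M ^+ r * \int[lebr]_z f z.
have d0 : 0 < d by rewrite mulr_gt0// exprn_gt0.
exists theta, (d / Q), fk; split => //; first exact: divr_gt0.
move=> k t; case: ifPn => tab; last exact/eqP/fk_off.
pose x := [tuple if l == k then t else a | l < r].
have xO : x \in Omega a b.
  by apply/in_Omega => l; rewrite tnth_mktuple; case: ifP.
have := lb _ xO; rewrite ler_pdivlMr// -/d fE (bigD1 k)//= tnth_mktuple eqxx.
rewrite (eq_bigr (fun l => fk l a)) => [|l /negbTE lk]; last first.
  by rewrite tnth_mktuple lk.
rewrite mulrCA -/(P k) => dle; rewrite ler_pdivrMr// (le_trans dle)//.
by rewrite ler_wpM2l.
Qed.

End initial_data.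

Theorem proposition3p2 (R : realType) (r m : nat) (a b h : R)
    (g : r.-tuple R -> R) (s : R -> R -> R -> R) (M1 : R -> R) (M2 B : R)
    (r_gt0 : (0 < r)%N) (ab : a < b)
    (g_density : density g)
    (g_support : support_in_interior_Omega a b g)
    (g_mixture : exists c : 'I_m -> r.-tuple R -> R,
      (forall j x, 0 <= c j x) /\ forall x, g x = \sum_(j < m) c j x)
    (s_kernel : smoothing_kernel a b (s h) (M1 h) M2 B)
    (e : nat -> 'I_m -> r.-tuple R -> R)
    (e0_product : forall j, product_component a b (e 0%N j))
    (e0_lower : forall j, component_lower_bound a b (M1 h) (e 0%N j))
    (eS : forall p j u, e p.+1 j u = nsmm_step a b (s h) g (e p) j u)
    (p : nat) :
  let D := (\sum_(j < m) KL (e p.+1 j) (e p j) +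
    \sum_(j < m) KL (fun x => (g x * weight a b (s h) (e p) j x)%R)
                    (fun x => (g x * weight a b (s h) (e p.+1) j x)%R))%E in
  let l := fun c : 'I_m -> r.-tuple R -> R => objective a b (s h) g c in
  (l (e p) = l (e p.+1) + D)%E /\
  (l (e p) \is a fin_num -> (l (e p) - l (e p.+1))%E = D).
Proof.
move=> D l.
have g_off := density_off g_support.
(* With no components [g] would be an empty sum, contradicting its integral 1. *)
have m0 : (0 < m)%N.
  rewrite lt0n; apply: contraTneq isT => m00; exfalso; subst m.
  have [c [_ gE]] := g_mixture; have := Rintegral_density g_density.
  under eq_Rintegral do rewrite gE big_ord0.
  by rewrite /Rintegral integral0 => /eqP; rewrite eq_sym oner_eq0.
have [M10 _] := kernel_bounds_gt0 s_kernel.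
have eSE n : e n.+1 = fun j => nsmm_step a b (s h) g (e n) j.
  by apply/funext => j; apply/funext => u; exact: eS.
have ereg n : regular_family a b (e n).
  elim: n => [j|n IH]; first exact: product_component_regular (e0_lower j).
  by rewrite eSE; exact: (nsmm_step_regular s_kernel g_density g_off m0 IH).
have [lE Dfin] := objective_decrease s_kernel g_density g_off r_gt0 m0
  (ereg p) (ereg p.+1) (eSE p).
split; first exact: lE.
(* A finite sum forces its summand [l (e p.+1)] to be finite, so it can be cancelled; if both
   objectives are +oo, only the additive identity is meaningful. *)
rewrite [l (e p)]lE -/D => lfin.
have l2fin : l (e p.+1) \is a fin_num by move: lfin; rewrite fin_numD => /andP[].
by rewrite addeAC subee// add0e.
Qed.
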